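(* Suppose $n=2^m-1$ for some integer $m\ge0$. Then $A_{n,0}(1)=1$, and $A_{n,k}(1)$ is an even integer for every $k\ge1$.
   Context: For a permutation $\sigma=b_1\ldots b_n$, $\mathrm{des}\,\sigma=\#\{i:b_i>b_{i+1}\}$ and $\mathrm{maj}\,\sigma=\sum_{b_i>b_{i+1}}i$. $\mathrm{Av}_n(321)$ is the set of permutations of $[n]$ with no $i<j<k$ such that $b_i>b_j>b_k$. $A_{n,k}(q)=\sum q^{\mathrm{maj}\,\sigma}$ over all $\sigma\in\mathrm{Av}_n(321)$ with $\mathrm{des}\,\sigma=k$; thus $A_{n,k}(1)$ is the number of $\sigma\in\mathrm{Av}_n(321)$ with exactly $k$ descents. *)

(* Defs.v *)
From mathcomp Require Import all_boot all_order all_fingroup all_algebra.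

Set Implicit Arguments.
Unset Strict Implicit.
Unset Printing Implicit Defensive.

Import GRing.Theory.
Local Open Scope ring_scope.

(* A permutation b_1 ... b_n of [n] is s : 'S_n with b_(i+1) = s i + 1, so
   positions and values are shifted down by one; only the definition of maj
   is sensitive to the shift. *)

Definition desset (n : nat) (s : 'S_n) : {set 'I_n} :=
  [set i : 'I_n | [exists j : 'I_n, (j == i.+1 :> nat) && (s j < s i)%N]].

Definition des (n : nat) (s : 'S_n) : nat := #|desset s|.

(* The index i : 'I_n stands for the position i.+1 of [n]. *)
Definition maj (n : nat) (s : 'S_n) : nat := (\sum_(i in desset s) i.+1)%N.

Definition Av321 (n : nat) : {set 'S_n} :=
  [set s : 'S_n | ~~ [exists i : 'I_n, exists j : 'I_n, exists k : 'I_n,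
     [&& (i < j)%N, (j < k)%N, (s j < s i)%N & (s k < s j)%N]]].

Definition A (n k : nat) : {poly int} :=
  \sum_(s in Av321 n | des s == k) 'X^(maj s).

(* Main.v *)
Require Import Defs.
From mathcomp Require Import all_boot all_order all_fingroup all_solvable all_algebra.
From mathcomp Require Import zify.

(** The reverse-complement [s |-> r s r], with [r] the reversal of [n], preserves
    321-avoidance and the number of descents, so modulo 2 only the fixed
    permutations count. For [n = 2p + 1] such a permutation fixes the centre
    [p]; an entry above [p] to the left of the centre would force, by symmetry,
    an entry below [p] to its right, hence a 321 pattern. So the fixed
    permutations are [t (+) 1 (+) rc t] with [t] in [Av_p(321)], and they have
    [2 des t] descents. Hence [A_{2p+1,k}(1)] is congruent to [A_{p,k/2}(1)], or
    to [0] if [k] is odd, and one concludes by induction on [m]. *)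

Local Open Scope nat_scope.

(* Extending [s] by the identity beyond [n] creates neither descents nor 321 patterns. *)
Definition ext {n : nat} (s : 'S_n) (i : nat) : nat :=
  if insub i is Some j then s j : nat else i.

Lemma ext_ord n (s : 'S_n) (i : 'I_n) : ext s i = s i.
Proof. by rewrite /ext valK. Qed.

Lemma ext_ge n (s : 'S_n) i : n <= i -> ext s i = i.
Proof. by move=> le_ni; rewrite /ext insubF // ltnNge le_ni. Qed.

Lemma ext_lt n (s : 'S_n) i : (ext s i < n) = (i < n).
Proof.
case: (ltnP i n) => [lt_in | le_ni]; last by rewrite ext_ge // ltnNge le_ni.
by rewrite (ext_ord _ s (Ordinal lt_in)) ltn_ord.
Qed.

Lemma ext_inj n (s : 'S_n) : injective (ext s).
Proof.
move=> i j eq_s; have := ext_lt _ s j; rewrite -eq_s ext_lt.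
case: (ltnP i n) (ltnP j n) => [lt_in | le_ni] [lt_jn | le_nj] // _.
  move: eq_s; rewrite (ext_ord _ s (Ordinal lt_in)) (ext_ord _ s (Ordinal lt_jn)).
  by move=> /val_inj/perm_inj [].
by rewrite !ext_ge // in eq_s.
Qed.

Lemma eq_ext n (s t : 'S_n) : (forall i, i < n -> ext s i = ext t i) -> s = t.
Proof.
by move=> eq_st; apply/permP=> i; apply: val_inj; rewrite /= -!ext_ord; apply: eq_st.
Qed.

(** The last term compares [ext s n = n] with a smaller value, so it vanishes. Keeping it serves
    [des_centro], where it becomes the comparison with the centre. *)
Lemma desE n (s : 'S_n) : des s = \sum_(0 <= i < n) (ext s i.+1 < ext s i).
Proof.
rewrite /des -sum1_card big_mkcond big_mkord; apply: eq_bigr => i _.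
rewrite inE ext_ord; case: existsP => [[j /andP[/eqP ji lt_ji]] | no_j].
  by rewrite -ji (ext_ord _ s j) lt_ji.
case: (ltnP i.+1 n) => [lt_in | le_ni]; last first.
  by rewrite ext_ge // ltnNge (leq_trans (ltnW (ltn_ord _))).
case: ltnP => // lt_s; case: no_j; exists (Ordinal lt_in).
by rewrite eqxx -ext_ord.
Qed.

Lemma desE_pred n (s : 'S_n) : des s = \sum_(0 <= i < n.-1) (ext s i.+1 < ext s i).
Proof.
rewrite desE; case: n s => [|n] s //; rewrite big_nat_recr //= [ext s n.+1]ext_ge //.
by have := ext_lt _ s n; lia.
Qed.

Lemma Av321P n (s : 'S_n) :
  reflect (forall i j l, i < j -> j < l -> l < n ->
             ext s j < ext s i -> ext s l < ext s j -> False)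
          (s \in Av321 n).
Proof.
rewrite inE; apply: (iffP idP) => [av i j l ij jl ln sji slj | av].
  have jn := ltn_trans jl ln; have lt_in := ltn_trans ij jn.
  case/existsP: av; exists (Ordinal lt_in); apply/existsP; exists (Ordinal jn).
  by apply/existsP; exists (Ordinal ln); rewrite -!ext_ord ij jl sji slj.
apply/existsP=> -[i /existsP[j /existsP[l]]]; rewrite -!ext_ord.
by case/and4P=> ij jl; apply: av.
Qed.

(** * Reverse-complement and the parity reduction *)

Definition rev_perm (n : nat) : 'S_n := perm (@rev_ord_inj n).

Lemma rev_permK n : (rev_perm n * rev_perm n)%g = 1%g.
Proof. by apply/permP=> i; rewrite permM !permE rev_ordK. Qed.

Lemma ext_rc n (s : 'S_n) i : i < n ->
  ext (s ^ rev_perm n)%g i = n.-1 - ext s (n.-1 - i).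
Proof.
move=> lt_in; rewrite (ext_ord _ _ (Ordinal lt_in)) conjgE.
have -> : ((rev_perm n)^-1 = rev_perm n)%g.
  by apply/eqP; rewrite eq_invg_mul rev_permK.
rewrite !permM /rev_perm [in LHS]permE [in X in s X]permE /= -ext_ord /=.
by rewrite (_ : n - i.+1 = n.-1 - i); lia.
Qed.

Lemma des_rc n (s : 'S_n) : des (s ^ rev_perm n)%g = des s.
Proof.
rewrite !desE_pred [RHS]big_nat_rev /= add0n; apply: eq_big_nat => i /andP[_ lt_i].
rewrite !ext_rc; [|lia|lia].
have -> : (n.-1 - i.+1).+1 = n.-1 - i by lia.
by have := ext_lt _ s (n.-1 - i); have := ext_lt _ s (n.-1 - i.+1); lia.
Qed.

(** The pattern 321 is its own reverse-complement: reflecting positions and values turns one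
    occurrence into another. *)
Lemma Av321_rc n (s : 'S_n) : s \in Av321 n -> (s ^ rev_perm n)%g \in Av321 n.
Proof.
move=> /Av321P av; apply/Av321P => i j l ij jl ln.
rewrite !ext_rc; [|lia..].
move=> sji slj; apply: (av (n.-1 - l) (n.-1 - j) (n.-1 - i)); lia.
Qed.

Definition Av_des (n k : nat) : {set 'S_n} := [set s in Av321 n | des s == k].

(** [rev_perm n] generates a 2-group acting by conjugation, so the non-trivial orbits have even
    size. *)
Lemma card_Av_des_mod2 n k :
  #|Av_des n k| = #|[set s in Av_des n k | (s ^ rev_perm n)%g == s]| %[mod 2].
Proof.
have p2 : (2.-group <[rev_perm n]>)%g.
  apply: (@pnat_dvd _ 2) => //; rewrite -orderE order_dvdn expgS expg1.
  by rewrite rev_permK.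
have actR : [acts <[rev_perm n]>%g, on Av_des n k | 'J%act].
  rewrite gen_subG sub1set; apply/astabsP => s /=.
  have step t : t \in Av_des n k -> (t ^ rev_perm n)%g \in Av_des n k.
    by case/setIdP=> /Av321_rc av dk; apply/setIdP; rewrite des_rc.
  (* Stability of the set is an equivalence; conjugating a second time by the involution gives the
     converse. *)
  apply/idP/idP => [/step|/step //].
  by rewrite -conjgM rev_permK conjg1.
rewrite (pgroup_fix_mod p2 actR); congr (#|pred_of_set _| %% 2).
apply/setP=> s; rewrite in_setI afix_gen_in ?sub1set ?inE //.
by rewrite sub1set inE.
Qed.

(** * Centrally symmetric 321-avoiding permutations *)

Definition centro_fun p (t : 'S_p) (i : nat) : nat :=
  if i <= p then ext t i else p.*2 - ext t (p.*2 - i).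

Lemma centro_fun_lt p (t : 'S_p) i : i < p.*2.+1 -> centro_fun p t i < p.*2.+1.
Proof.
rewrite /centro_fun => lt_i; case: (leqP i p) => [le_ip|]; last lia.
by have := ext_lt _ t i; have := ext_ge _ t i; lia.
Qed.

(** Positions before, at and after the centre take values below, equal to and above [p], so a
    collision stays on one side, where [ext t] is injective. *)
Lemma centro_fun_inj p (t : 'S_p) :
  injective (fun i : 'I_p.*2.+1 => inord (centro_fun p t i) : 'I_p.*2.+1).
Proof.
move=> i j /(congr1 val); rewrite /= !inordK ?centro_fun_lt // => eq_f.
apply: val_inj => /=; have lt_i := ltn_ord i; have lt_j := ltn_ord j.
move: eq_f; rewrite /centro_fun.
have := ext_lt _ t i; have := ext_lt _ t j.
have := ext_lt _ t (p.*2 - i); have := ext_lt _ t (p.*2 - j).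
have := ext_ge _ t i; have := ext_ge _ t j.
have inj := ext_inj _ t.
case: (leqP i p) (leqP j p) => [ip|ip] [jp|jp] => *.
- exact: inj.
- lia.
- lia.
- suff: p.*2 - i = p.*2 - j by lia.
  by apply: inj; lia.
Qed.

(* The direct sum [t (+) 1 (+) rc t]. *)
Definition centro p (t : 'S_p) : 'S_(p.*2.+1) := perm (centro_fun_inj p t).

Lemma ext_centro p (t : 'S_p) i : i <= p.*2 -> ext (centro p t) i = centro_fun p t i.
Proof.
move=> le_i; rewrite (ext_ord _ _ (Ordinal (le_i : i < p.*2.+1))) permE /=.
by rewrite inordK // centro_fun_lt.
Qed.

Lemma ext_centro_l p (t : 'S_p) i : i <= p -> ext (centro p t) i = ext t i.
Proof. by move=> le_i; rewrite ext_centro /centro_fun ?le_i //; lia. Qed.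

Lemma ext_centro_r p (t : 'S_p) i : p <= i -> i <= p.*2 ->
  ext (centro p t) i = p.*2 - ext t (p.*2 - i).
Proof.
move=> le_pi le_i; rewrite ext_centro // /centro_fun; case: leqP => // le_ip.
have -> : i = p by lia.
by rewrite !ext_ge; lia.
Qed.

Lemma centro_inj p : injective (centro p).
Proof.
move=> s t eq_st; apply: eq_ext => i lt_i.
by rewrite -[LHS]ext_centro_l 1?ltnW // eq_st ext_centro_l // ltnW.
Qed.

Lemma rc_centro p (t : 'S_p) : (centro p t ^ rev_perm p.*2.+1)%g = centro p t.
Proof.
apply: eq_ext => i lt_i; rewrite ext_rc //=.
case: (leqP i p) => [le_ip | lt_pi].
  rewrite ext_centro_r ?ext_centro_l; [|lia..].
  have -> : p.*2 - (p.*2 - i) = i by lia.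
  have := ext_lt _ t i; have := ext_ge _ t i; lia.
by rewrite ext_centro_l ?ext_centro_r; lia.
Qed.

Lemma des_centro p (t : 'S_p) : des (centro p t) = (des t).*2.
Proof.
rewrite desE_pred /= (big_cat_nat (n := p)) //=; last lia.
rewrite -[RHS]addnn; congr (_ + _); rewrite [RHS]desE.
  by apply: eq_big_nat => i /andP[_ lt_i]; rewrite !ext_centro_l // ltnW.
(* After shifting and reversing the right half, index [i] compares positions [2p - i - 1] and
   [2p - i], the mirror image of [i] and [i + 1] in [t]. *)
rewrite -[X in \sum_(X <= _ < _) _]add0n big_addn (_ : p.*2 - p = p); last lia.
rewrite big_nat_rev /=; apply: eq_big_nat => i /andP[_ lt_i].
rewrite !ext_centro_r; [|lia..].
have -> : p.*2 - (0 + p - i.+1 + p).+1 = i by lia.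
have -> : p.*2 - (0 + p - i.+1 + p) = i.+1 by lia.
have := ext_lt _ t i; have := ext_lt _ t i.+1; have := ext_ge _ t i.+1; lia.
Qed.

(** Values increase from block to block of the direct sum, so an occurrence of 321 lies in a single
    block; one in the right block reflects to one in [t]. *)
Lemma Av321_centro p (t : 'S_p) : (centro p t \in Av321 p.*2.+1) = (t \in Av321 p).
Proof.
apply/Av321P/Av321P => av i j l ij jl ln.
  by rewrite -!(ext_centro_l p t); [apply: av => //|..]; lia.
have tlt := ext_lt _ t; have tge := ext_ge _ t.
case: (leqP l p) => [le_lp | lt_pl].
  have [lt_lp | eq_lp] := ltnP l p; first by rewrite !ext_centro_l; [apply: av|..]; lia.
  rewrite !ext_centro_l; [|lia..].
  by have := tge l; have := tlt j; lia.
case: (leqP i p) => [le_ip | lt_pi]; last first.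
  rewrite !ext_centro_r; [|lia..] => sji slj.
  apply: (av (p.*2 - l) (p.*2 - j) (p.*2 - i)); lia.
(* Now [i] is at most [p] and [l] exceeds it, so the value at [i] is at most [p] and the one at [l]
   exceeds [p]: no decrease from [i] to [l] is possible. *)
rewrite (ext_centro_l _ _ i) // (ext_centro_r _ _ l); [|lia..].
case: (leqP j p) => [le_jp | lt_pj].
  rewrite ext_centro_l //.
  by have := tlt j; have := tge j; have := tlt (p.*2 - l); lia.
rewrite ext_centro_r; [|lia..].
by have := tlt i; have := tge i; have := tlt (p.*2 - j); lia.
Qed.

Lemma centro_surj p (s : 'S_(p.*2.+1)) :
  s \in Av321 p.*2.+1 -> (s ^ rev_perm p.*2.+1)%g = s -> exists t, s = centro p t.
Proof.
move=> /Av321P av sym.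
have rcs i : i <= p.*2 -> ext s i + ext s (p.*2 - i) = p.*2.
  move=> le_i; have := ext_rc _ s i le_i; rewrite sym /=.
  by have := ext_lt _ s (p.*2 - i); lia.
have mid : ext s p = p.
  by have := rcs p; rewrite (_ : p.*2 - p = p); lia.
have low i : i < p -> ext s i < p.
  move=> lt_ip; rewrite ltnNge; apply/negP => le_p.
  have ne_p : ext s i <> p by rewrite -{2}mid => /ext_inj; lia.
  by apply: (av i p (p.*2 - i)); rewrite ?mid; have := rcs i; lia.
have low_ord (i : 'I_p) : ext s i < p by apply: low.
have inj : injective (fun i => Ordinal (low_ord i)).
  by move=> i j [/ext_inj/val_inj].
(* The case [i = p] holds because the identity extension agrees with [s] at its fixed centre. *)
have tE i : i <= p -> ext (perm inj) i = ext s i.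
  rewrite leq_eqVlt => /predU1P[-> | lt_i]; first by rewrite mid ext_ge.
  by rewrite (ext_ord _ _ (Ordinal lt_i)) permE.
exists (perm inj); apply: eq_ext => i lt_i.
case: (leqP i p) => [le_ip | lt_pi]; first by rewrite ext_centro_l // tE.
rewrite ext_centro_r ?tE; [|lia..].
by have := rcs i; lia.
Qed.

Lemma fixed_Av_des p k :
  [set s in Av_des p.*2.+1 k | (s ^ rev_perm p.*2.+1)%g == s]
    = centro p @: [set t in Av321 p | (des t).*2 == k].
Proof.
apply/setP=> s; apply/setIdP/imsetP => [[/setIdP[av dk] /eqP sym] | [t]].
  have [t def_s] := centro_surj _ _ av sym; exists t => //.
  by apply/setIdP; rewrite -Av321_centro -des_centro -def_s.
case/setIdP=> av dk ->; rewrite rc_centro; split=> //.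
by apply/setIdP; rewrite Av321_centro des_centro.
Qed.

(** * Induction on [m], and the case of no descents *)

Lemma dvdn2_card_Av_des m k : 0 < k -> 2 %| #|Av_des (2 ^ m - 1) k|.
Proof.
elim: m k => [|m IHm] k k_gt0.
  rewrite eq_card0 // => s; rewrite inE desE big_geq //.
  by case: k k_gt0 => // k _; rewrite andbF.
have -> : 2 ^ m.+1 - 1 = (2 ^ m - 1).*2.+1 by rewrite expnS; have := expn_gt0 2 m; lia.
rewrite /dvdn card_Av_des_mod2 fixed_Av_des card_imset; last exact: centro_inj.
rewrite -/(dvdn _ _); case: (boolP (odd k)) => [odd_k | even_k].
  rewrite eq_card0 // => t; rewrite inE.
  by case: eqP => [def_k|]; [rewrite -def_k odd_double in odd_k | rewrite andbF].
rewrite (_ : [set t in _ | _] = Av_des (2 ^ m - 1) k./2); first by apply: IHm; lia.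
by apply/setP=> t; rewrite !in_set; congr (_ && _); lia.
Qed.

(** An increasing sequence of values in [0..n-1] satisfies [i <= s i] by induction from the left,
    and [s i <= i] by induction from the right end. *)
Lemma des_eq0 n (s : 'S_n) : des s = 0 -> s = 1%g.
Proof.
rewrite desE_pred big_mkord => /eqP; rewrite sum_nat_eq0 => /forallP inc.
have step i : i.+1 < n -> ext s i < ext s i.+1.
  move=> lt_i; have lt_i' : i < n.-1 by lia.
  have := inc (Ordinal lt_i'); rewrite /= eqb0 -leqNgt leq_eqVlt.
  by case/predU1P => // /ext_inj; lia.
have lower i : i < n -> i <= ext s i.
  by elim: i => // i IHi lt_i; have := step _ lt_i; have := IHi (ltnW lt_i); lia.
have upper d i : i + d = n.-1 -> i < n -> ext s i <= i.
  elim: d i => [|d IHd] i eq_n lt_i; first by have := ext_lt _ s i; lia.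
  by have := step i; have := IHd i.+1; lia.
apply: eq_ext => i lt_i; rewrite (ext_ord _ 1%g (Ordinal lt_i)) perm1 /=.
by have := lower i lt_i; have := upper (n.-1 - i) i; lia.
Qed.

Lemma Av_des0 n : Av_des n 0 = [set 1%g].
Proof.
have ext1 i : ext (1%g : 'S_n) i = i.
  case: (ltnP i n) => [lt_i | /ext_ge //].
  by rewrite (ext_ord _ _ (Ordinal lt_i)) perm1.
apply/setP=> s; rewrite in_set in_set1; apply/andP/eqP => [[_ /eqP/des_eq0 //] | ->].
split; last by rewrite desE big1 // => i _; rewrite !ext1 ltnNge leqnSn.
by apply/Av321P => i j l ij jl ln; rewrite !ext1; lia.
Qed.

Local Open Scope ring_scope.

(** Every monomial evaluates to 1, so [maj] disappears and only the count remains. *)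
Lemma horner1_A n k : (A n k).[1] = #|Av_des n k|%:Z.
Proof.
rewrite /A horner_sum (eq_bigr (fun=> 1)) => [|s _].
  rewrite -natz -GRing.sumr_const; apply: eq_bigl => s.
  by rewrite [RHS]in_set.
by rewrite hornerXn GRing.expr1n.
Qed.

Theorem theorem7p5 (n m : nat) (hn : n = (2 ^ m - 1)%N) :
  (A n 0).[1] = 1 /\
  (forall k : nat, (1 <= k)%N -> (2 %| (A n k).[1])%Z).
Proof.
split=> [|k k_gt0]; first by rewrite horner1_A Av_des0 cards1.
by rewrite horner1_A hn dvdzE /= dvdn2_card_Av_des.
Qed.
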